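(* Let $\mathfrak g$ be the Kac-Moody algebra of a symmetrizable generalized Cartan matrix $A=(a_{ij})_{i,j=1}^r$, let $z_1,\dots,z_n$ be distinct complex numbers, $\Lambda_1,\dots,\Lambda_n\in\mathfrak h^*$ weights, $l_1,\dots,l_r$ nonnegative integers and $\boldsymbol t=(t^{(i)}_j)_{i=1,\dots,r;\ j=1,\dots,l_i}$ complex numbers. Put $P_i(x)=\prod_{j=1}^{l_i}(t^{(i)}_j-x)$ and $T_i(x)=\prod_{s=1}^n(x-z_s)^{\langle\Lambda_s,\alpha_i^\vee\rangle}$ for $i=1,\dots,r$. Assume that the roots $\boldsymbol t$ of the polynomials $P_1,\dots,P_r$ are all simple, distinct and different from $z_1,\dots,z_n$. Then $\boldsymbol t$ is a solution of the Bethe ansatz equations $$-\sum_{s=1}^n\frac{(\Lambda_s,\alpha_i)}{t_j^{(i)}-z_s}+\sum_{s,\,s\ne i}\sum_{k=1}^{l_s}\frac{(\alpha_s,\alpha_i)}{t_j^{(i)}-t_k^{(s)}}+\sum_{s,\,s\ne j}\frac{(\alpha_i,\alpha_i)}{t_j^{(i)}-t_s^{(i)}}=0,\qquad i=1,\dots,r,\ j=1,\dots,l_i,$$ if and only if there exist numbers $\mu_1,\dots,\mu_n$ with $\mu_1+\dots+\mu_n=0$ such that $$\sum_{i=1}^r(\alpha_i,\alpha_i)\frac{P_i''}{P_i}+\sum_{i\ne j}(\alpha_i,\alpha_j)\frac{P_i'P_j'}{P_iP_j}-\sum_{i=1}^r(\alpha_i,\alpha_i)\frac{T_i'P_i'}{T_iP_i}+\sum_{s=1}^n\frac1{x-z_s}\Bigl(\mu_s-\sum_{k\ne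 s}\frac{(\Lambda_s,\Lambda_k)}{z_s-z_k}\Bigr)=0,$$ where the sum $\sum_{i\neq j}$ is over ordered pairs $(i,j)$ with $i,j\in\{1,\dots,r\}$, $i\ne j$.
   Context: $A=(a_{ij})_{i,j=1}^r$ is a generalized Cartan matrix: $a_{ii}=2$, $a_{ij}\in\mathbb Z_{\le0}$ for $i\ne j$, and $a_{ij}=0$ iff $a_{ji}=0$; symmetrizable means there are positive integers $d_1,\dots,d_r$ with $\mathrm{diag}(d_1,\dots,d_r)A$ symmetric. $\mathfrak g=\mathfrak g(A)$ is the corresponding complex Kac-Moody Lie algebra, $\mathfrak h\subset\mathfrak g$ its Cartan subalgebra, $\alpha_i\in\mathfrak h^*$ and $\alpha_i^\vee\in\mathfrak h$ the simple roots and coroots, $(\cdot,\cdot)$ the associated nondegenerate scalar product (symmetric bilinear form) on $\mathfrak h^*$; it satisfies $(\alpha_i,\alpha_j)=d_ia_{ij}$ and $\langle\lambda,\alpha_i^\vee\rangle=2(\lambda,\alpha_i)/(\alpha_i,\alpha_i)$ for $\lambda\in\mathfrak h^*$. Primes denote derivatives in $x$; $T_i'/T_i$ is the rational function $\sum_{s=1}^n\langle\Lambda_s,\alpha_i^\vee\rangle/(x-z_s)$. *)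

(* Defs.v *)
From HB Require Import structures.
From mathcomp Require Import all_boot all_order all_algebra.
From mathcomp Require Import fraction.
From mathcomp Require Import reals complex.

Set Implicit Arguments.
Unset Strict Implicit.
Unset Printing Implicit Defensive.

Import Order.TTheory GRing.Theory Num.Theory.
Local Open Scope ring_scope.

Definition generalized_cartan_matrix (r : nat) (A : 'M[int]_r) : Prop :=
  [/\ forall i, A i i = 2,
      forall i j, i != j -> A i j <= 0
    & forall i j, A i j = 0 <-> A j i = 0].

Definition symmetrized_by (r : nat) (A : 'M[int]_r) (d : 'I_r -> nat) : Prop :=
  (forall i, (0 < d i)%N) /\
  let DA := diag_mx (\row_i (d i)%:Z) *m A in DA^T = DA.

Record lie_algebra (K : fieldType) := LieAlgebra {
  lie_sort :> lmodType K;
  lie_bracket : {bilinear lie_sort -> lie_sort -> lie_sort};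
  lie_bracketxx : forall x, lie_bracket x x = 0;
  lie_jacobi : forall x y z,
    lie_bracket x (lie_bracket y z) + lie_bracket y (lie_bracket z x)
      + lie_bracket z (lie_bracket x y) = 0
}.

Arguments lie_bracket {K g} : rename.

Definition lie_subspace (K : fieldType) (g : lie_algebra K)
    (S : g -> Prop) : Prop :=
  S 0 /\ forall (c : K) x y, S x -> S y -> S (c *: x + y).

Definition lie_subalgebra (K : fieldType) (g : lie_algebra K)
    (S : g -> Prop) : Prop :=
  lie_subspace S /\ forall x y, S x -> S y -> S (lie_bracket x y).

Definition lie_ideal (K : fieldType) (g : lie_algebra K)
    (S : g -> Prop) : Prop :=
  lie_subspace S /\ forall x y, S y -> S (lie_bracket x y).

(* The Kac-Moody algebra g(A) with its realization (h, {alpha_i}, {alpha_i^vee})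
   and Chevalley generators e_i, f_i.  It is the quotient of the Lie algebra
   presented by h, e_i, f_i and the four bracket relations below by its largest
   ideal meeting h trivially; [km_generated] and [km_no_ideal] say exactly that
   the algebra is this quotient.  The Cartan subalgebra is the image of
   [km_embed]. *)
Record kac_moody (K : fieldType) (r : nat) (A : 'M[int]_r) := KacMoody {
  km_algebra :> lie_algebra K;
  km_cartan : vectType K;
  km_embed : {linear km_cartan -> km_algebra};
  km_root : 'I_r -> 'Hom(km_cartan, K^o);
  km_coroot : 'I_r -> km_cartan;
  km_e : 'I_r -> km_algebra;
  km_f : 'I_r -> km_algebra;
  km_dim_cartan :
    (\dim {: km_cartan} + \rank (map_mx intr A : 'M[K]_r) = 2 * r)%N;
  km_root_free : free [tuple km_root i | i < r];
  km_coroot_free : free [tuple km_coroot i | i < r];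
  km_pairing : forall i j, km_root j (km_coroot i) = (A i j)%:~R;
  km_embed_inj : injective km_embed;
  km_bracket_ef : forall i j,
    lie_bracket (km_e i) (km_f j)
      = if i == j then km_embed (km_coroot i) else 0;
  km_bracket_hh : forall h h',
    lie_bracket (km_embed h) (km_embed h') = 0;
  km_bracket_he : forall h i,
    lie_bracket (km_embed h) (km_e i) = (km_root i h : K) *: km_e i;
  km_bracket_hf : forall h i,
    lie_bracket (km_embed h) (km_f i) = - (km_root i h : K) *: km_f i;
  km_generated : forall S : km_algebra -> Prop, lie_subalgebra S ->
    (forall h, S (km_embed h)) -> (forall i, S (km_e i)) ->
    (forall i, S (km_f i)) -> forall x, S x;
  km_no_ideal : forall S : km_algebra -> Prop, lie_ideal S ->
    (forall h, S (km_embed h) -> h = 0) -> forall x, S x -> x = 0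
}.

(* The dual h^* of the Cartan subalgebra. *)
Definition weight (K : fieldType) (r : nat) (A : 'M[int]_r)
    (g : kac_moody K A) : vectType K := 'Hom(km_cartan g, K^o).

Definition pairing (K : fieldType) (r : nat) (A : 'M[int]_r)
    (g : kac_moody K A) (lam : weight g) (h : km_cartan g) : K :=
  (lam : 'Hom(km_cartan g, K^o)) h.

Definition simple_root (K : fieldType) (r : nat) (A : 'M[int]_r)
    (g : kac_moody K A) (i : 'I_r) : weight g := km_root g i.

(* These conditions fix (lam, alpha_i) for every weight lam; the forms
   satisfying them are the standard forms attached to the symmetrization d,
   which differ only by the choice of a complement in h to the span of the
   coroots. *)
Definition standard_form (K : fieldType) (r : nat) (A : 'M[int]_r)
    (d : 'I_r -> nat) (g : kac_moody K A) (form : {symmetric (weight g)}) :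
    Prop :=
  [/\ nondegenerate form,
      forall i j,
        form (simple_root g i) (simple_root g j) = (d i)%:R * (A i j)%:~R
    & forall (lam : weight g) i,
        pairing lam (km_coroot g i)
          = 2 * form lam (simple_root g i)
              / form (simple_root g i) (simple_root g i)].

Notation "p %:F" := (@FracField.tofrac _ p) : ring_scope.

Definition bethe_poly (K : fieldType) (r : nat) (l : 'I_r -> nat)
    (t : forall i : 'I_r, 'I_(l i) -> K) (i : 'I_r) : {poly K} :=
  \prod_(j < l i) ((t i j)%:P - 'X).

(* T_i'/T_i.  The exponents <Lambda_s, alpha_i^vee> of
   T_i = prod_s (x - z_s)^<Lambda_s, alpha_i^vee> are arbitrary scalars, so only
   this logarithmic derivative is a rational function. *)
Definition dlog_T (K : fieldType) (r : nat) (A : 'M[int]_r)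
    (g : kac_moody K A) (n : nat) (z : 'I_n -> K) (Lam : 'I_n -> weight g)
    (i : 'I_r) : {fraction {poly K}} :=
  \sum_(s < n) ((pairing (Lam s) (km_coroot g i))%:P)%:F / ('X - (z s)%:P)%:F.

(* Main.v *)
(* The left-hand side of the differential identity is a rational function with
   at most simple poles, at the t^(i)_j and the z_s, and without polynomial
   part, so it vanishes iff all its residues do.  The residue at t^(i)_j is
   twice the left-hand side of the Bethe equation (i, j), while the residue at
   z_s vanishes for exactly one value of mu_s.  These values sum to zero because,
   after summing over all s and using the Bethe equations, only sums of
   antisymmetric terms over ordered pairs remain. *)

From HB Require Import structures.
Require Import Defs.
From mathcomp Require Import all_boot all_order all_algebra.
From mathcomp Require Import fraction reals complex ring.

Set Implicit Arguments.
Unset Strict Implicit.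
Unset Printing Implicit Defensive.

Import Order.TTheory GRing.Theory Num.Theory.
Local Open Scope ring_scope.

(** * Partial fractions and independence of simple poles *)

Section SimplePoles.
Variable K : fieldType.
Implicit Types (a b c : K) (I : finType).

Definition fconst c : {fraction {poly K}} := c%:P%:F.

Definition simple_pole a : {fraction {poly K}} := (('X - a%:P)%:F)^-1.

Local Notation "c %:K" := (fconst c) (at level 2, format "c %:K").
Local Notation pole := simple_pole.

Lemma fconst_is_zmod_morphism : zmod_morphism fconst.
Proof. by move=> a b; rewrite /fconst !rmorphB. Qed.

Lemma fconst_is_monoid_morphism : monoid_morphism fconst.
Proof. by split=> [|a b]; rewrite /fconst ?rmorph1 // !rmorphM. Qed.

HB.instance Definition _ :=
  GRing.isZmodMorphism.Build K {fraction {poly K}} fconst fconst_is_zmod_morphism.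
HB.instance Definition _ :=
  GRing.isMonoidMorphism.Build K {fraction {poly K}} fconst
    fconst_is_monoid_morphism.

Lemma XsubC_frac_neq0 a : ('X - a%:P)%:F != 0 :> {fraction {poly K}}.
Proof. by rewrite tofrac_eq0 polyXsubC_eq0. Qed.

(** Partial fractions: divide [a - b = (X - b) - (X - a)] by [(X - a) * (X - b)]. *)
Lemma simple_pole_mul a b :
  a != b -> pole a * pole b = ((a - b)^-1)%:K * (pole a - pole b).
Proof.
move=> ab; have ab0 : (a - b)%:K != 0 by rewrite fmorph_eq0 subr_eq0.
rewrite fmorphV; apply: (mulfI ab0); rewrite (mulVKf ab0) /simple_pole.
have -> : (a - b)%:K = ('X - b%:P)%:F - ('X - a%:P)%:F.
  by rewrite /fconst -rmorphB /= polyCB; congr (_ %:F); ring.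
move: (XsubC_frac_neq0 a) (XsubC_frac_neq0 b).
move: ('X - a%:P)%:F ('X - b%:P)%:F => x y x0 y0.
by rewrite mulrBl [x^-1 * _]mulrC mulVKf // [y^-1 * _]mulrC mulVKf.
Qed.

(** Clearing denominators gives a polynomial identity. At [p i] every summand but the [i]-th
    vanishes, and the cofactor [Q i] is nonzero there because the poles are distinct. *)
Lemma simple_poles_independent I (p c : I -> K) : injective p ->
  \sum_i (c i)%:K * pole (p i) = 0 -> forall i, c i = 0.
Proof.
move=> p_inj sum0 i.
pose Q j := \prod_(k | k != j) ('X - (p k)%:P).
have poleE j : pole (p j) * (\prod_k ('X - (p k)%:P))%:F = (Q j)%:F.
  by rewrite (bigD1 j) //= rmorphM /= mulKf ?XsubC_frac_neq0.
have : \sum_j (c j)%:P * Q j = 0.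
  apply/eqP; rewrite -tofrac_eq0 rmorph_sum /=; apply/eqP.
  transitivity ((\sum_j (c j)%:K * pole (p j)) * (\prod_k ('X - (p k)%:P))%:F).
    by rewrite mulr_suml; apply: eq_bigr => j _; rewrite -mulrA poleE rmorphM.
  by rewrite sum0 mul0r.
move/(congr1 (fun q => q.[p i])); rewrite horner0 horner_sum (bigD1 i) //=.
rewrite big1 => [|j ji]; last first.
  rewrite hornerM horner_prod (bigD1 i) 1?eq_sym //=.
  by rewrite hornerXsubC subrr mul0r mulr0.
rewrite addr0 hornerM hornerC horner_prod => /eqP.
rewrite mulf_eq0 => /orP[/eqP //|/prodf_eq0[j ji]].
by rewrite hornerXsubC subr_eq0 (inj_eq p_inj) eq_sym (negPf ji).
Qed.

(** * Derivatives of products of linear factors *)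

Lemma subCX_frac_pole a : (a%:P - 'X)%:F * pole a = -1.
Proof. by rewrite -opprB rmorphN /= mulNr mulfV ?XsubC_frac_neq0. Qed.

(** Leibniz rule, by induction on the product. The predicate [D] lets the formula apply also to a
    product with one factor removed. *)
Lemma frac_deriv_prod I (D : pred I) (p : I -> K) :
  (\prod_(i | D i) ((p i)%:P - 'X))^`()%:F
    = (\prod_(i | D i) ((p i)%:P - 'X))%:F * \sum_(i | D i) pole (p i).
Proof.
apply: (big_rec2 (fun q s => q^`()%:F = q%:F * s)) => [|i q s _ IH].
  by rewrite derivC rmorph0 mulr0.
rewrite derivM derivB derivC derivX sub0r mulN1r rmorphD rmorphN !rmorphM /= IH.
by rewrite mulrDr [_ * _ * pole _]mulrAC subCX_frac_pole mulN1r mulrA.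
Qed.

(** The first derivative is the sum of the [- Q i], the products lacking one factor; each of these
    is then differentiated by [frac_deriv_prod]. *)
Lemma frac_deriv2_prod I (p : I -> K) :
  (\prod_i ((p i)%:P - 'X))^`()^`()%:F
    = (\prod_i ((p i)%:P - 'X))%:F
      * \sum_i \sum_(j | j != i) pole (p i) * pole (p j).
Proof.
pose Q i := \prod_(j | j != i) ((p j)%:P - 'X).
have poleE i : (\prod_j ((p j)%:P - 'X))%:F * pole (p i) = - (Q i)%:F.
  by rewrite (bigD1 i) //= rmorphM /= mulrAC subCX_frac_pole mulN1r.
have -> : (\prod_i ((p i)%:P - 'X))^`() = \sum_i - Q i.
  apply/eqP; rewrite -tofrac_eq frac_deriv_prod rmorph_sum mulr_sumr /=.
  by apply/eqP; apply: eq_bigr => i _; rewrite poleE rmorphN.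
rewrite raddf_sum rmorph_sum mulr_sumr /=; apply: eq_bigr => i _.
by rewrite derivN rmorphN /= frac_deriv_prod -mulNr -poleE -mulr_sumr mulrA.
Qed.

(** * Residues and the Bethe equations *)

Lemma sum_antisymmetric I (f : I -> I -> K) : 2 != 0 :> K ->
    (forall i j, f j i = - f i j) ->
  \sum_i \sum_(j | j != i) f i j = 0.
Proof.
move=> two_neq0 fN; set S := LHS; suff : S = - S.
  move/eqP; rewrite -subr_eq0 opprK -mulr2n -mulr_natl mulf_eq0.
  by rewrite (negPf two_neq0) => /eqP.
rewrite {1}/S (exchange_big_dep predT) //= -sumrN; apply: eq_bigr => i _.
rewrite -sumrN; apply: eq_big => [j|j _]; first by rewrite eq_sym.
exact: fN.
Qed.

(** By partial fractions an ordered pair contributes to the poles at both of its points. As [w] is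
    symmetric, the pairs [(i, j)] and [(j, i)] contribute equally at [p i], whence the factor 2. *)
Lemma sum_simple_pole_mul I (p : I -> K) (w : I -> I -> K) :
    injective p -> (forall i j, w i j = w j i) ->
  \sum_i \sum_(j | j != i) (w i j)%:K * (pole (p i) * pole (p j))
    = \sum_i (2 * \sum_(j | j != i) w j i / (p i - p j))%:K * pole (p i).
Proof.
move=> p_inj wC.
pose c i j := (w j i / (p i - p j))%:K.
transitivity (\sum_i \sum_(j | j != i) (c i j * pole (p i) + c j i * pole (p j))).
  apply: eq_bigr => i _; apply: eq_bigr => j ji.
  have -> : c j i = - c i j by rewrite /c wC -rmorphN -mulrN -invrN opprB.
  rewrite simple_pole_mul ?(inj_eq p_inj) 1?eq_sym // mulrA -rmorphM /= mulrBr.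
  by rewrite wC mulNr.
under eq_bigr do rewrite big_split /=.
rewrite big_split /= [X in _ + X](exchange_big_dep predT) //= -big_split /=.
apply: eq_bigr => i _; rewrite rmorphM rmorph_sum rmorph_nat /=.
under [X in _ + X]eq_bigl do rewrite eq_sym.
by rewrite -!mulr_suml -mulrA -mulr2n mulr_natl.
Qed.

(** The theorem freed of Lie theory: [p] lists all the Bethe roots in one family, and [w], [u], [v]
    stand for the scalar products root-root, weight-root and weight-weight. *)
Lemma bethe_residues I (S : finType) (p : I -> K) (z : S -> K)
    (w : I -> I -> K) (u : S -> I -> K) (v : S -> S -> K) :
    2 != 0 :> K -> injective p -> injective z -> (forall i s, p i != z s) ->
    (forall i j, w i j = w j i) -> (forall s k, v s k = v k s) ->
  (forall i, - (\sum_s u s i / (p i - z s))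
             + \sum_(j | j != i) w j i / (p i - p j) = 0)
  <->
  (exists mu : S -> K, \sum_s mu s = 0 /\
     \sum_i \sum_(j | j != i) (w i j)%:K * (pole (p i) * pole (p j))
     - \sum_i \sum_s (2 * u s i)%:K * (pole (z s) * pole (p i))
     + \sum_s (mu s - \sum_(k | k != s) v s k / (z s - z k))%:K * pole (z s)
     = 0).
Proof.
move=> two_neq0 p_inj z_inj pz wC vC.
(* Half the residue at [p i], and the residue at [z s] without its [mu s]. *)
pose resp i := - (\sum_s u s i / (p i - z s))
             + \sum_(j | j != i) w j i / (p i - p j).
pose resz s := 2 * \sum_i u s i / (p i - z s)
  - \sum_(k | k != s) v s k / (z s - z k).
have expand (mu : S -> K) :
    \sum_i \sum_(j | j != i) (w i j)%:K * (pole (p i) * pole (p j))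
     - \sum_i \sum_s (2 * u s i)%:K * (pole (z s) * pole (p i))
     + \sum_s (mu s - \sum_(k | k != s) v s k / (z s - z k))%:K * pole (z s)
    = \sum_i (2 * resp i)%:K * pole (p i)
      + \sum_s (mu s + resz s)%:K * pole (z s).
  rewrite sum_simple_pole_mul //.
  have -> : \sum_i \sum_s (2 * u s i)%:K * (pole (z s) * pole (p i))
    = \sum_i (2 * \sum_s u s i / (p i - z s))%:K * pole (p i)
      - \sum_s (2 * \sum_i u s i / (p i - z s))%:K * pole (z s).
    under eq_bigr => i _.
      under eq_bigr => s _.
        rewrite [pole _ * _]mulrC simple_pole_mul // mulrA -rmorphM -mulrA mulrBr.
        over.
      rewrite sumrB -mulr_suml -rmorph_sum -mulr_sumr.
      over.
    rewrite sumrB [X in _ - X]exchange_big /=; congr (_ - _).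
    apply: eq_bigr => s _.
    by rewrite -mulr_suml -rmorph_sum -mulr_sumr.
  rewrite opprB addrA [_ + _ - _]addrAC -sumrB -addrA -big_split /=.
  congr (_ + _); apply: eq_bigr => i _.
    by rewrite -mulrBl -rmorphB; congr (_%:K * _); rewrite /resp; ring.
  by rewrite -mulrDl -rmorphD; congr (_%:K * _); rewrite /resz; ring.
split=> [bae|[mu [_ eq0]] i].
  have {}bae i : resp i = 0 by exact: bae.
  (* The only choice that cancels the residues at the [z s]. *)
  exists (fun s => - resz s); split; last first.
    rewrite expand; under eq_bigr do rewrite bae mulr0 rmorph0 mul0r.
    by rewrite big1 // add0r big1 // => s _; rewrite addNr rmorph0 mul0r.
  (* The [v] terms are antisymmetric: [v] is symmetric and [z s - z k] changes sign. *)
  rewrite sumrN sumrB [X in _ - X]sum_antisymmetric //; last first.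
    by move=> s k; rewrite vC -mulrN -invrN opprB.
  rewrite subr0 -mulr_sumr exchange_big /=.
  (* The Bethe equations trade the [u] terms for [w] terms, which are again antisymmetric. *)
  have -> : \sum_i \sum_s u s i / (p i - z s)
    = \sum_i \sum_(j | j != i) w j i / (p i - p j) - \sum_i resp i.
    by rewrite -sumrB; apply: eq_bigr => i _; rewrite /resp; ring.
  rewrite sum_antisymmetric // => [|i j].
    by rewrite (eq_bigr (fun=> 0)) // big1 // subr0 mulr0 oppr0.
  by rewrite wC -mulrN -invrN opprB.
(* Both kinds of poles are merged into one injective family, so that independence applies to all of
   them at once. *)
pose q (x : I + S) := match x with inl i => p i | inr s => z s end.
pose c (x : I + S) :=
  match x with inl i => 2 * resp i | inr s => mu s + resz s end.
have q_inj : injective q.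
  move=> [i1|s1] [i2|s2] /= => [/p_inj -> //|/eqP|/esym/eqP|/z_inj -> //].
    by rewrite (negPf (pz _ _)).
  by rewrite (negPf (pz _ _)).
have /(simple_poles_independent q_inj)/(_ (inl i))/eqP :
    \sum_x (c x)%:K * pole (q x) = 0 by rewrite big_sumType -[RHS]eq0 expand.
by rewrite mulf_eq0 (negPf two_neq0) => /eqP.
Qed.

Lemma prod_subCX_frac_neq0 I (p : I -> K) :
  (\prod_i ((p i)%:P - 'X))%:F != 0 :> {fraction {poly K}}.
Proof.
rewrite tofrac_eq0 prodf_seq_neq0; apply/allP => i _.
by rewrite -opprB oppr_eq0 polyXsubC_eq0.
Qed.

Lemma bethe_poly_dlog r (l : 'I_r -> nat) (t : forall i, 'I_(l i) -> K) i :
  (bethe_poly t i)^`()%:F / (bethe_poly t i)%:F = \sum_j pole (t i j).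
Proof. by rewrite frac_deriv_prod mulrC mulKf ?prod_subCX_frac_neq0. Qed.

Lemma bethe_poly_dlog2 r (l : 'I_r -> nat) (t : forall i, 'I_(l i) -> K) i :
  (bethe_poly t i)^`()^`()%:F / (bethe_poly t i)%:F
    = \sum_j \sum_(k | k != j) pole (t i j) * pole (t i k).
Proof. by rewrite frac_deriv2_prod mulrC mulKf ?prod_subCX_frac_neq0. Qed.

End SimplePoles.

(** * Passage from the Kac-Moody data to a single family of roots *)

(** A pair differs from [(i, j)] either in the second component alone or already in the first; these
    are the two root sums of the Bethe equations. *)
Lemma sum_tagged_neq (V : nmodType) (I : finType) (J : I -> finType)
    (i : I) (j : J i) (H : {k : I & J k} -> V) :
  \sum_(b | b != Tagged J j) H b
    = \sum_(k | k != j) H (Tagged J k)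
      + \sum_(k | k != i) \sum_(m : J k) H (Tagged J m).
Proof.
have -> : \sum_(b | b != Tagged J j) H b
    = \sum_k \sum_(m : J k | Tagged J m != Tagged J j) H (Tagged J m).
  by rewrite (sig_big_dep _ (fun k m => Tagged J m != Tagged J j)
    (fun k m => H (Tagged J m))); apply: eq_big => -[].
rewrite (bigD1 i) //=; congr (_ + _).
  by apply: eq_bigl => k; rewrite -tag_eqE /tag_eq eqxx /= tagged_asE.
apply: eq_bigr => k ki; apply: eq_bigl => m.
by rewrite -tag_eqE /tag_eq /= (negPf ki).
Qed.

Theorem theorem7p4p1 (R : realType) (r : nat) (A : 'M[int]_r) (d : 'I_r -> nat)
    (hA : generalized_cartan_matrix A) (hd : symmetrized_by A d)
    (g : kac_moody R[i] A)
    (form : {symmetric (weight g)}) (hform : standard_form d form)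
    (n : nat) (z : 'I_n -> R[i]) (hz : injective z)
    (Lam : 'I_n -> weight g)
    (l : 'I_r -> nat) (t : forall i : 'I_r, 'I_(l i) -> R[i])
    (ht_simple : forall i, injective (t i))
    (ht_distinct : forall i i' j j', i != i' -> t i j != t i' j')
    (ht_z : forall i j s, t i j != z s) :
  let alpha := simple_root g in
  let P := bethe_poly t in
  (forall (i : 'I_r) (j : 'I_(l i)),
      - (\sum_(s < n) form (Lam s) (alpha i) / (t i j - z s))
      + \sum_(s < r | s != i) \sum_(k < l s)
          form (alpha s) (alpha i) / (t i j - t s k)
      + \sum_(s < l i | s != j) form (alpha i) (alpha i) / (t i j - t i s)
      = 0)
  <->
  (exists mu : 'I_n -> R[i],
      \sum_(s < n) mu s = 0 /\
      \sum_(i < r) ((form (alpha i) (alpha i))%:P)%:F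
          * ((P i)^`()^`()%:F / (P i)%:F)
      + \sum_(i < r) \sum_(j < r | j != i)
          ((form (alpha i) (alpha j))%:P)%:F
          * (((P i)^`()%:F * (P j)^`()%:F) / ((P i)%:F * (P j)%:F))
      - \sum_(i < r) ((form (alpha i) (alpha i))%:P)%:F
          * (dlog_T z Lam i * ((P i)^`()%:F / (P i)%:F))
      + \sum_(s < n) (1 / ('X - (z s)%:P)%:F)
          * ((mu s - \sum_(k < n | k != s)
                       form (Lam s) (Lam k) / (z s - z k))%:P)%:F
      = 0).
Proof.
move=> alpha P.
(* This number is [2 * d i] with [d i] positive. *)
have aa_neq0 i : form (alpha i) (alpha i) != 0.
  have [hAii _ _] := hA; have [hd0 _] := hd; have [_ -> _] := hform.
  by rewrite hAii mulf_neq0 ?intr_eq0 // pnatr_eq0 -lt0n.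
have formC x y : form x y = form y x by rewrite hermC expr0 mul1r.
have aa_pairing s i : form (alpha i) (alpha i) * pairing (Lam s) (km_coroot g i)
    = 2 * form (Lam s) (alpha i).
  by have [_ _ ->] := hform; rewrite mulrC divfK // aa_neq0.
(* The roots of all the [P i] are indexed together by the dependent pairs [(i, j)]. *)
pose p (a : {i & 'I_(l i)}) := t (tag a) (tagged a).
pose w (a b : {i & 'I_(l i)}) : R[i] := form (alpha (tag a)) (alpha (tag b)).
pose u s (a : {i & 'I_(l i)}) : R[i] := form (Lam s) (alpha (tag a)).
have p_inj : injective p.
  move=> [i j] [i' j']; rewrite /p /=; case: (eqVneq i i') => [ii'|ii' /eqP].
    by case: i' / ii' j' => j' /ht_simple ->.
  by rewrite (negPf (ht_distinct _ _ _ _ ii')).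
have two_neq0 : 2 != 0 :> R[i] by rewrite pnatr_eq0.
have residues := bethe_residues (v := fun s k => form (Lam s) (Lam k)) u
  two_neq0 p_inj hz (fun a s => ht_z _ _ s)
  (fun a b => formC _ _ : w a b = w b a)
  (fun s k => formC _ _).
have pairsE : \sum_(i < r) ((form (alpha i) (alpha i))%:P)%:F
          * ((P i)^`()^`()%:F / (P i)%:F)
      + \sum_(i < r) \sum_(j < r | j != i)
          ((form (alpha i) (alpha j))%:P)%:F
          * (((P i)^`()%:F * (P j)^`()%:F) / ((P i)%:F * (P j)%:F))
    = \sum_a \sum_(b | b != a)
        fconst (w a b) * (simple_pole (p a) * simple_pole (p b)).
  (* The second derivatives supply the pairs of roots of one [P i], the products of first
     derivatives those of two different ones. *)
  transitivity (\sum_i \sum_(j : 'I_(l i))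
      (\sum_(k | k != j) fconst (form (alpha i) (alpha i))
         * (simple_pole (t i j) * simple_pole (t i k))
       + \sum_(i' | i' != i) \sum_(k : 'I_(l i'))
           fconst (form (alpha i) (alpha i'))
         * (simple_pole (t i j) * simple_pole (t i' k)))).
    rewrite -big_split; apply: eq_bigr => i _ /=; rewrite big_split /=.
    congr (_ + _).
      rewrite bethe_poly_dlog2 mulr_sumr; apply: eq_bigr => j _.
      by rewrite mulr_sumr.
    rewrite exchange_big /=; apply: eq_bigr => i' _.
    rewrite -mulf_div !bethe_poly_dlog mulr_suml mulr_sumr.
    by apply: eq_bigr => j _; rewrite !mulr_sumr.
  rewrite (sig_big_dep predT (fun i j => true)) /=.
  by apply: eq_bigr => -[i j] _; rewrite sum_tagged_neq.
(* By [aa_pairing] the coroot pairings in [dlog_T] turn into [2 * u s a]. *)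
have mixedE : \sum_(i < r) ((form (alpha i) (alpha i))%:P)%:F
          * (dlog_T z Lam i * ((P i)^`()%:F / (P i)%:F))
    = \sum_a \sum_s
        fconst (2 * u s a) * (simple_pole (z s) * simple_pole (p a)).
  transitivity (\sum_i \sum_(j : 'I_(l i)) \sum_s
      fconst (2 * form (Lam s) (alpha i))
      * (simple_pole (z s) * simple_pole (t i j))); last first.
    by rewrite (sig_big_dep predT (fun i j => true)).
  apply: eq_bigr => i _; rewrite bethe_poly_dlog !mulr_sumr.
  apply: eq_bigr => j _; rewrite mulr_suml mulr_sumr.
  by apply: eq_bigr => s _; rewrite -aa_pairing rmorphM -!mulrA.
have polesE (c : 'I_n -> R[i]) :
    \sum_(s < n) (1 / ('X - (z s)%:P)%:F) * ((c s)%:P)%:F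
    = \sum_s fconst (c s) * simple_pole (z s).
  by apply: eq_bigr => s _; rewrite div1r mulrC.
rewrite pairsE mixedE.
split=> [bae|[mu [mu0 eq0]] i j].
  have /residues[mu [mu0 eq0]] : forall a, - (\sum_s u s a / (p a - z s))
             + \sum_(b | b != a) w b a / (p a - p b) = 0.
    move=> [i j]; rewrite sum_tagged_neq -[RHS](bae i j) -addrA.
    by congr (_ + _); rewrite addrC.
  by exists mu; split=> //; rewrite polesE.
have /residues/(_ (Tagged _ j)) : exists mu' : 'I_n -> R[i], \sum_s mu' s = 0 /\
    \sum_a \sum_(b | b != a)
      fconst (w a b) * (simple_pole (p a) * simple_pole (p b))
    - \sum_a \sum_s fconst (2 * u s a) * (simple_pole (z s) * simple_pole (p a))
    + \sum_s fconst (mu' s - \sum_(k | k != s) form (Lam s) (Lam k) / (z s - z k))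
             * simple_pole (z s) = 0.
  by exists mu; split=> //; rewrite -polesE.
rewrite sum_tagged_neq => bae; rewrite -[RHS]bae -addrA.
by congr (_ + _); rewrite addrC.
Qed.
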